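(* Let $d\in\mathbb{N}$, let $r$ be a fixed non-negative integer and let $1\le p<\infty$. There is a positive constant $C$, not depending on $f$ (nor on $n$), such that for every $f\in M(Q_d)$ and all $n\in\mathbb{N}$ with $n>2r$, $$\left\|K_{n,r}^{d}(f)-f\right\|_p\le C\,\tau_1\left(f,\sqrt[2d]{\frac{3n+1+3r(r-1)}{12(n+1)^2}}\right)_p .$$
   Context: Notation: $Q_d:=[0,1]^d$; $\|\cdot\|_p$ is the standard norm of $L^p(Q_d)$ (Lebesgue measure); $\|\mathbf{x}\|_\infty=\max_{1\le i\le d}|x_i|$ on $\mathbb{R}^d$. $M(Q_d)$ is the set of bounded measurable real-valued functions on $Q_d$. Averaged modulus of smoothness: for $f\in M(Q_d)$, $\delta>0$ and $\mathbf{x}\in Q_d$, the local modulus of smoothness of first order is $$\omega_1(f,\mathbf{x};\delta)=\sup\left\{|f(\mathbf{t}+\mathbf{h})-f(\mathbf{t})| : \mathbf{t},\mathbf{t}+\mathbf{h}\in Q_d,\ \|\mathbf{t}-\mathbf{x}\|_\infty\le\tfrac{\delta}{2},\ \|\mathbf{t}+\mathbf{h}-\mathbf{x}\|_\infty\le\tfrac{\delta}{2}\right\},$$ with $\mathbf{h}\in\mathbb{R}^d$, and the first order averaged modulus ($\tau$-modulus) is $\tau_1(f,\delta)_p:=\|\omega_1(f,\cdot;\delta)\|_p$. Operators: for non-negative integers $m$ and integers $k$, $p_{m,k}(x)=\binom{m}{k}x^k(1-x)^{m-k}$ if $0\le k\le m$ and $p_{m,k}(x)=0$ if $k<0$ or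 $k>m$, $x\in[0,1]$. For a non-negative integer $r$ and a natural number $n>2r$, Stancu's fundamental functions are, for $x\in[0,1]$ and $0\le k\le n$, $$w_{n,k,r}(x)=\begin{cases}(1-x)p_{n-r,k}(x), & 0\le k<r,\\ (1-x)p_{n-r,k}(x)+x\,p_{n-r,k-r}(x), & r\le k\le n-r,\\ x\,p_{n-r,k-r}(x), & n-r<k\le n.\end{cases}$$ For $\mathbf{k}=(k_1,\ldots,k_d)\in\{0,\ldots,n\}^d$ and $\mathbf{x}=(x_1,\ldots,x_d)\in Q_d$ put $w_{n,\mathbf{k},r}(\mathbf{x}):=\prod_{i=1}^d w_{n,k_i,r}(x_i)$. The multivariate Brass-Stancu-Kantorovich operators are defined, for $n>2r$ and $f\in L^1(Q_d)$, by $$K_{n,r}^{d}(f;\mathbf{x})=\sum_{\mathbf{k}\in\{0,\ldots,n\}^d} w_{n,\mathbf{k},r}(\mathbf{x})\int_{Q_d} f\left(\frac{\mathbf{k}+\mathbf{u}}{n+1}\right)d\mathbf{u},\qquad \mathbf{x}\in Q_d,$$ and $K_{n,r}^d(f)$ denotes the function $\mathbf{x}\mapsto K_{n,r}^d(f;\mathbf{x})$. *)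

(* Defs.v *)
From HB Require Import structures.
From mathcomp Require Import all_boot all_order all_algebra.
From mathcomp Require Import all_classical all_reals all_analysis.

Set Implicit Arguments.
Unset Strict Implicit.
Unset Printing Implicit Defensive.
Import Order.TTheory GRing.Theory Num.Theory.
Import numFieldNormedType.Exports.

Local Open Scope classical_set_scope.
Local Open Scope ring_scope.

Section LebesgueMeasure.
Context (R : realType).
Local Notation mR := (measurableTypeR R).

Definition tcons (d : nat) (z : mR * d.-tuple mR) : d.+1.-tuple mR :=
  [tuple of z.1 :: z.2].

Definition tuncons (d : nat) (t : d.+1.-tuple mR) : mR * d.-tuple mR :=
  (thead t, [tuple of behead t]).

Lemma measurable_tcons (d : nat) : measurable_fun setT (@tcons d).
Proof. exact: measurable_cons. Qed.

Lemma measurable_tuncons (d : nat) : measurable_fun setT (@tuncons d).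
Proof.
by apply: measurable_fun_pair; [exact: measurable_tnth|exact: measurable_behead].
Qed.

Lemma tconsK (d : nat) : cancel (@tcons d) (@tuncons d).
Proof. by move=> [a t]; congr (_, _); apply: val_inj. Qed.

Lemma tunconsK (d : nat) : cancel (@tuncons d) (@tcons d).
Proof. by move=> t; rewrite [in RHS](tuple_eta t); apply: val_inj. Qed.

Section Cons.
Context (d : nat) (mu : {sigma_finite_measure set (d.-tuple mR) -> \bar R}).

Definition cons_measure : set (d.+1.-tuple mR) -> \bar R :=
  pushforward (lebesgue_measure \x mu)%E (@tcons d).

Let cons_measure0 : cons_measure set0 = 0%E.
Proof. by rewrite /cons_measure /pushforward preimage_set0 measure0. Qed.

Let cons_measure_ge0 A : (0 <= cons_measure A)%E.
Proof. by rewrite /cons_measure /pushforward; exact: measure_ge0. Qed.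

Let cons_measure_sigma_additive : semi_sigma_additive cons_measure.
Proof.
have mE A : measurable A -> measurable (@tcons d @^-1` A).
  by move=> mA; rewrite -[X in measurable X]setTI; exact: measurable_tcons.
move=> F mF tF mUF; rewrite /cons_measure /pushforward preimage_bigcup.
apply: measure_semi_sigma_additive.
- by move=> n; exact: (mE _ (mF n)).
- apply/trivIsetP => i j _ _ ij; rewrite -preimage_setI.
  by move/trivIsetP : tF => /(_ _ _ _ _ ij) ->//; rewrite preimage_set0.
- by rewrite -preimage_bigcup; exact: mE.
Qed.

HB.instance Definition _ := isMeasure.Build _ _ _ cons_measure
  cons_measure0 cons_measure_ge0 cons_measure_sigma_additive.

Let cons_measure_sigma_finite : sigma_finite setT cons_measure.
Proof.
have /sigma_finiteP[F [TF ndF Foo]] := sigma_finiteT (@lebesgue_measure R).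
have /sigma_finiteP[G [TG ndG Goo]] := sigma_finiteT mu.
exists (fun n => @tuncons d @^-1` (F n `*` G n)).
  rewrite -preimage_bigcup [X in _ @^-1` X](_ : _ = setT) ?preimage_setT//.
  rewrite -subTset => -[x y] _.
  have [n _ Fnx] : (\bigcup_k F k) x by rewrite -TF.
  have [k _ Gky] : (\bigcup_k G k) y by rewrite -TG.
  exists (maxn n k) => //; split => /=.
  - by move: x Fnx; exact/subsetPset/ndF/leq_maxl.
  - by move: y Gky; exact/subsetPset/ndG/leq_maxr.
move=> n; have [mF Fn] := Foo n; have [mG Gn] := Goo n; split.
  rewrite -[X in measurable X]setTI.
  by apply: measurable_tuncons => //; exact: measurableX.
rewrite /cons_measure /pushforward -comp_preimage.
rewrite (_ : _ \o _ = id); last by apply/funext => z /=; rewrite tconsK.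
by rewrite product_measure1E// lte_mul_pinfty// ge0_fin_numE.
Qed.

HB.instance Definition _ := Measure_isSigmaFinite.Build _ _ _ cons_measure
  cons_measure_sigma_finite.

End Cons.

Fixpoint borel_lebesgue (d : nat) :
    {sigma_finite_measure set (d.-tuple mR) -> \bar R} :=
  if d is d'.+1 then cons_measure (borel_lebesgue d') else dirac [tuple].

(* R^d with the complete sigma-algebra of its Lebesgue-measurable sets, which
   are the Caratheodory-measurable sets of the outer measure induced by the
   Borel product measure. Borel sets would not be enough: the local modulus of
   a Borel function need not be Borel when 1 < d. *)
Definition euclidean (d : nat) : Type :=
  caratheodory_type (borel_lebesgue d)^*%mu.

HB.instance Definition _ (d : nat) := Measurable.on (euclidean d).

Definition lebesgue (d : nat) : set (euclidean d) -> \bar R :=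
  @completed_measure_extension _ _ _ (borel_lebesgue d).
HB.instance Definition _ (d : nat) := Measure.on (@lebesgue d).

End LebesgueMeasure.

Arguments borel_lebesgue R d : clear implicits.
Arguments euclidean R d : clear implicits.
Arguments lebesgue R d : clear implicits.

Section AveragedModulus.
Context (R : realType) (d : nat).
Implicit Types (f g : d.-tuple R -> R) (x t h : d.-tuple R) (p delta : R).

Definition tadd x t : d.-tuple R := [tuple tnth x i + tnth t i | i < d].

Definition tsub x t : d.-tuple R := [tuple tnth x i - tnth t i | i < d].

Definition supnorm x : R := \big[Num.max/0]_(i < d) `|tnth x i|.

Definition unit_cube : set (d.-tuple R) :=
  [set x | forall i, 0 <= tnth x i <= 1].

(* Functions on the cube are represented by functions on R^d whose values
   outside the cube are irrelevant. *)
Definition bounded_measurable f : Prop :=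
  measurable_fun (unit_cube : set (euclidean R d)) (f : euclidean R d -> R) /\
  [bounded f x | x in unit_cube].

Definition cube_Lnorm p g : \bar R :=
  'N[lebesgue R d]_(p%:E)[EFin \o (g \_ unit_cube)].

Definition local_modulus f x delta : R :=
  sup [set s | exists t h,
    [/\ unit_cube t, unit_cube (tadd t h),
        supnorm (tsub t x) <= delta / 2,
        supnorm (tsub (tadd t h) x) <= delta / 2
      & s = `|f (tadd t h) - f t|]].

Definition averaged_modulus f delta p : \bar R :=
  cube_Lnorm p (fun x => local_modulus f x delta).

End AveragedModulus.

Arguments unit_cube R d : clear implicits.

Section BrassStancuKantorovich.
Context (R : realType).

Definition bernstein (m k : nat) (x : R) : R :=
  if (k <= m)%N then 'C(m, k)%:R * x ^+ k * (1 - x) ^+ (m - k) else 0.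

(* Only meant for 2 * r < n and k <= n; then no subtraction is truncated. *)
Definition stancu (n k r : nat) (x : R) : R :=
  if (k < r)%N then (1 - x) * bernstein (n - r) k x
  else if (k <= n - r)%N then
    (1 - x) * bernstein (n - r) k x + x * bernstein (n - r) (k - r) x
  else x * bernstein (n - r) (k - r) x.

Definition kantorovich (d n r : nat) (f : d.-tuple R -> R) (x : d.-tuple R) : R :=
  \sum_(k : d.-tuple 'I_n.+1)
    (\prod_(i < d) stancu n (tnth k i) r (tnth x i)) *
    \int[lebesgue R d]_(u in unit_cube R d)
      f [tuple ((tnth k i)%:R + tnth u i) / n.+1%:R | i < d].

End BrassStancuKantorovich.

(* Main.v *)
Require Import Defs.
From mathcomp Require Import all_boot all_order all_algebra.
From mathcomp Require Import all_classical all_reals all_analysis.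
From mathcomp Require Import measurable_realfun.
From mathcomp Require Import zify ring lra.

Import Order.TTheory GRing.Theory Num.Theory.
Import numFieldNormedType.Exports.

Local Open Scope ring_scope.
Local Open Scope classical_set_scope.

(** The kernel of the operator is concentrated, with exponential tails, at
    distance of order n^(-1/2), whereas the step delta of the modulus is at
    least (2/5) (n + 1)^(-1/2) for every d ([modulus_step_ge]). So everything
    can be discretised at the single scale n^(-1/2).

    Cut the cube into M^d equal closed cells, with M of order n^(1/2) and
    4 / M <= delta, and let b_l be the infimum over the cell l of the local
    modulus of f ([cell_modulus]). Points of neighbouring cells are within
    delta / 2 of every point of either cell, so f oscillates by at most b_l
    between the cell l and a neighbour. Walking from cell to cell,
    |f x - f y| is at most the sum of the b_l over the box of cells centred at
    that of x with the cell of y at a corner ([chain_cells]).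

    For x in the cell i, averaging this bound over the kernel gives b_l as
    coefficient the probability that a point drawn from the kernel is, in each
    coordinate, at least |l_c - i_c| cells away. The generating function of
    Stancu's weights is explicit, which bounds exponential moments of the
    distance ([stancu_exp_moment]), and this probability decays geometrically
    in each coordinate: |K f x - f x| <= A^d sum_l E_il^2 b_l with
    E_il = prod_c rho^|l_c - i_c| ([kantorovich_cell_estimate]).

    What remains is a convolution with a summable kernel, bounded on the l^p
    space of the set of cells ([sum_powR_sqr_kernel]), and two comparisons of
    integrals with step functions: the error is at most a step function, and
    the local modulus is at least the step function with values b_l, so that
    sum_l b_l^p M^(-d) is at most the p-th power of the averaged modulus
    ([cube_power_integral_le], [cube_power_integral_ge]). *)

(** * Monotonicity of the integral *)

Section LowerIntegral.
Context {disp : measure_display} {T : measurableType disp} {R : realType}.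
Variable mu : {measure set T -> \bar R}.
Local Open Scope ereal_scope.

(** The integral of a nonnegative function is a supremum over the simple
    functions below it, hence monotone on all functions. This is what compares
    the local modulus and the dilated copies of f with step functions and
    constants without a study of their measurability. *)
Lemma ge0_le_lower_integral (f1 f2 : T -> \bar R) :
  (forall x, 0 <= f1 x) -> (forall x, f1 x <= f2 x) ->
  \int[mu]_x f1 x <= \int[mu]_x f2 x.
Proof.
move=> f10 f12.
have f20 x : 0 <= f2 x by exact: le_trans (f12 x).
rewrite !ge0_integralTE//; apply: ereal_sup_le => _ [h hf <-].
by exists h => // x; exact: le_trans (hf x) (f12 x).
Qed.

(** The positive part increases with the function and the negative part
    decreases, so the two nonnegative integrals move in the right directions. *)
Lemma le_lower_integral (D : set T) (f1 f2 : T -> \bar R) :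
  (forall x, D x -> f1 x <= f2 x) ->
  \int[mu]_(x in D) f1 x <= \int[mu]_(x in D) f2 x.
Proof.
move=> f12; rewrite (integralE mu D f1) (integralE mu D f2).
have f12D : {in D, forall x, f1 x <= f2 x} by move=> x /set_mem; exact: f12.
have fp x : D x -> f1^\+ x <= f2^\+ x by move/mem_set; exact: funepos_le.
have fn x : D x -> f2^\- x <= f1^\- x by move/mem_set; exact: funeneg_le.
by apply: leeB; rewrite integral_mkcond [leRHS]integral_mkcond;
  apply: ge0_le_lower_integral => x; rewrite ?erestrict_ge0//;
  exact: lee_restrict.
Qed.

(** An average stays as close to c as the averaged values; the integrals of the
    constants c - B and c + B enclose the integral of g, which is finite. *)
Lemma normr_Rintegral_sub_le (D : set T) (g : T -> R) (c B : R) :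
  measurable D -> mu D = 1 ->
  (forall x, D x -> `|g x - c| <= B)%R ->
  (`|\int[mu]_(x in D) g x - c| <= B)%R.
Proof.
move=> mD muD gcB.
have cst r : \int[mu]_(x in D) r%:E = r%:E by rewrite integral_cst// muD mule1.
have {}gcB x : D x -> (c - B <= g x <= c + B)%R by move/gcB; rewrite ler_distl.
have lo : (c - B)%:E <= \int[mu]_(x in D) (g x)%:E.
  by rewrite -cst; apply: le_lower_integral => x /gcB /andP[]; rewrite lee_fin.
have hi : \int[mu]_(x in D) (g x)%:E <= (c + B)%:E.
  by rewrite -cst; apply: le_lower_integral => x /gcB /andP[]; rewrite lee_fin.
rewrite /Rintegral ler_distl; move: lo hi.
by case: (\int[mu]_(x in D) _) => [r| |]//=; rewrite !lee_fin => -> ->.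
Qed.

End LowerIntegral.

(** * Lebesgue measure of boxes *)

Section BoxMeasure.
Context {R : realType}.
Local Notation mR := (measurableTypeR R).

Definition box {d : nat} (I : 'I_d -> interval R) : set (d.-tuple R) :=
  [set x | forall c, tnth x c \in I c].

Lemma measurable_box (d : nat) (I : 'I_d -> interval R) :
  measurable (box I : set (d.-tuple mR)).
Proof.
have -> : box I =
    \bigcap_(c in setT) ((fun x : d.-tuple mR => tnth x c) @^-1` [set` I c]).
  by apply/seteqP; split => x /= h c; [move=> _; exact: h | exact: (h c)].
apply: fin_bigcap_measurable => // c _.
rewrite -[X in measurable X]setTI; apply: measurable_tnth => //.
Qed.

(** Equal side lengths suffice: the boxes of interest are the cube and the
    cells of a uniform grid. *)
Lemma borel_lebesgue_box (d : nat) (I : 'I_d -> interval R) (a : R) :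
  (forall c, lebesgue_measure [set` I c] = a%:E) ->
  borel_lebesgue R d (box I) = (a ^+ d)%:E.
Proof.
elim: d I => [|d IH] I Ia.
  by rewrite /= diracE mem_set// => -[].
rewrite /= /cons_measure /pushforward.
have -> : @tcons R d @^-1` box I =
    [set` I ord0] `*` box (fun c => I (lift ord0 c)).
  apply/seteqP; split => [[x t]|[x t]] /=.
    move=> h; split => [|c]; first exact: (h ord0).
    by have := h (lift ord0 c); rewrite tnthS.
  case=> /= h0 h c; have [c' ->|->] := unliftP ord0 c.
    by rewrite tnthS; exact: h.
  exact: h0.
rewrite product_measure1E//; last exact: measurable_box.
by rewrite [X in (X * _)%E](Ia ord0) [X in (_ * X)%E]IH// -EFinM exprS.
Qed.

Lemma measurable_box_euclidean (d : nat) (I : 'I_d -> interval R) :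
  measurable (box I : set (euclidean R d)).
Proof.
by apply: sub_caratheodory; apply: sub_sigma_algebra; exact: measurable_box.
Qed.

Lemma lebesgue_box (d : nat) (I : 'I_d -> interval R) (a : R) :
  (forall c, lebesgue_measure [set` I c] = a%:E) ->
  lebesgue R d (box I) = (a ^+ d)%:E.
Proof.
move=> Ia; rewrite -(borel_lebesgue_box _ _ _ Ia).
by apply: measurable_mu_extE; exact: measurable_box.
Qed.

Lemma unit_cube_box (d : nat) : unit_cube R d = box (fun _ => `[0, 1]%R).
Proof.
by apply/seteqP; split => x /= h c; have := h c; rewrite in_itv.
Qed.

Lemma measurable_unit_cube (d : nat) :
  measurable (unit_cube R d : set (euclidean R d)).
Proof. by rewrite unit_cube_box; exact: measurable_box_euclidean. Qed.

Lemma lebesgue_unit_cube (d : nat) : lebesgue R d (unit_cube R d) = 1%E.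
Proof.
rewrite unit_cube_box (lebesgue_box _ _ 1) ?expr1n// => _.
by rewrite lebesgue_measure_itv/= lte_fin ltr01 oppr0 adde0.
Qed.

End BoxMeasure.

(** * Exponential moments of Stancu's weights *)

Section StancuMoments.
Context {R : realType}.
Implicit Types (x z lam : R).

Lemma bernstein_ge0 (m k : nat) x : 0 <= x <= 1 -> 0 <= bernstein m k x.
Proof.
move=> /andP[x0 x1]; rewrite /bernstein; case: ifP => // _.
by rewrite !mulr_ge0// exprn_ge0// subr_ge0.
Qed.

Lemma bernstein_gf (m n : nat) x z : (m <= n)%N ->
  \sum_(k < n.+1) bernstein m k x * z ^+ k = (1 - x + x * z) ^+ m.
Proof.
move=> mn; rewrite exprDn (big_ord_widen n.+1
  (fun k => (1 - x) ^+ (m - k) * (x * z) ^+ k *+ 'C(m, k)))//.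
rewrite [RHS]big_mkcond /=; apply: eq_bigr => k _; rewrite /bernstein ltnS.
by case: ifP => _; rewrite ?mul0r// exprMn -mulr_natl; ring.
Qed.

(** The three ranges of k merge into one formula, because the Bernstein
    polynomial of degree n - r vanishes for k > n - r. *)
Lemma stancuE (n k r : nat) x : (2 * r < n)%N ->
  stancu n k r x = (1 - x) * bernstein (n - r) k x +
    (if (r <= k)%N then x * bernstein (n - r) (k - r) x else 0).
Proof.
move=> rn; rewrite /stancu ltnNge; case: leqP => rk /=; last by rewrite addr0.
case: leqP => // kn.
by rewrite [X in (1 - x) * X]/bernstein leqNgt kn/= mulr0 add0r.
Qed.

Lemma stancu_ge0 (n k r : nat) x : (2 * r < n)%N -> 0 <= x <= 1 ->
  0 <= stancu n k r x.
Proof.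
move=> rn x01; rewrite stancuE// addr_ge0//; last case: ifP => // _;
  by rewrite mulr_ge0 ?bernstein_ge0//; lra.
Qed.

(** The weights are the law of S + r * T with S binomial of parameters
    (n - r, x) and T Bernoulli of parameter x, independent of S; this is the
    product of their generating functions. *)
Lemma stancu_gf (n r : nat) x z : (2 * r < n)%N ->
  \sum_(k < n.+1) stancu n k r x * z ^+ k =
  (1 - x + x * z) ^+ (n - r) * (1 - x + x * z ^+ r).
Proof.
move=> rn; under eq_bigr => k _ do rewrite stancuE// mulrDl -mulrA.
rewrite big_split/= -mulr_sumr bernstein_gf ?leq_subr//.
rewrite mulrDr [X in X + _]mulrC; congr (_ + _).
rewrite -(big_mkord xpredT (fun k => (if (r <= k)%N then
  x * bernstein (n - r) (k - r) x else 0) * z ^+ k)).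
rewrite (big_cat_nat (n := r))//=; last by lia.
rewrite big_nat big1 ?add0r; last first.
  by move=> k /andP[_ kr]; rewrite leqNgt kr mul0r.
rewrite -[X in \sum_(X <= _ < _) _]add0n big_addn.
rewrite (_ : (n.+1 - r = (n - r).+1)%N); last by lia.
rewrite big_mkord -(bernstein_gf _ _ _ _ (leqnn _)) mulr_suml.
by apply: eq_bigr => k _; rewrite leq_addl addnK exprD; ring.
Qed.

Lemma sum_stancu (n r : nat) x : (2 * r < n)%N ->
  \sum_(k < n.+1) stancu n k r x = 1.
Proof.
move=> rn; have := stancu_gf n r x 1 rn.
under eq_bigr => k _ do rewrite expr1n mulr1.
by rewrite expr1n mulr1 subrK expr1n mulr1.
Qed.

(** Inverting exp (- lam) >= 1 - lam gives exp lam <= 1 / (1 - lam), which is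
    1 + lam + lam^2 / (1 - lam), and 1 - lam >= 1 / 2. *)
Lemma expR_le_quadratic lam : `|lam| <= 1 / 2 ->
  expR lam <= 1 + lam + 2 * lam ^+ 2.
Proof.
rewrite ler_norml => /andP[lo hi].
have := expR_ge1Dx (- lam); rewrite expRN => h.
have e0 := expR_gt0 lam.
have : expR lam * (1 - lam) <= 1.
  by rewrite -ler_pdivlMl// mulr1.
nra.
Qed.

(** With S and T as for the generating function, the binomial part contributes
    at most exp ((n - r) x (exp lam - 1)), whose linear term in lam almost
    cancels against (n + 1) x lam; the quadratic term is bounded since
    4 lam^2 (n + 1) <= 1, and the shift by r costs a factor depending on r
    only. *)
Lemma stancu_mgf (n r : nat) x lam : (2 * r < n)%N -> 0 <= x <= 1 ->
  `|lam| <= 1 / 2 -> 4 * lam ^+ 2 * n.+1%:R <= 1 ->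
  \sum_(k < n.+1) stancu n k r x * expR (lam * (k%:R - n.+1%:R * x)) <=
  expR (r%:R + 1).
Proof.
move=> rn /andP[x0 x1] lam2 lamn.
have rn' : (r <= n)%N by lia.
have -> : \sum_(k < n.+1) stancu n k r x * expR (lam * (k%:R - n.+1%:R * x)) =
  (1 - x + x * expR lam) ^+ (n - r) * (1 - x + x * expR lam ^+ r) *
    expR (- (lam * (n.+1%:R * x))).
  rewrite -stancu_gf// mulr_suml; apply: eq_bigr => k _.
  by rewrite mulrBr expRD expRM_natr mulrA.
have e0 := expR_gt0 lam.
have A : (1 - x + x * expR lam) ^+ (n - r) <=
    expR ((n%:R - r%:R) * (x * (lam + 2 * lam ^+ 2))).
  rewrite -natrB// expRM_natl; apply: lerXn2r; rewrite ?nnegrE ?expR_ge0//.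
    by nra.
  apply: le_trans (expR_ge1Dx _).
  by have := expR_le_quadratic _ lam2; nra.
have B : 1 - x + x * expR lam ^+ r <= expR (r%:R * `|lam|).
  have h1 : 1 <= expR (r%:R * `|lam|) by rewrite -[1]expR0 ler_expR mulr_ge0.
  have h2 : expR lam ^+ r <= expR (r%:R * `|lam|).
    by rewrite -expRM_natl ler_expR ler_wpM2l// ler_norm.
  nra.
apply: le_trans (_ : expR ((n%:R - r%:R) * (x * (lam + 2 * lam ^+ 2))) *
   expR (r%:R * `|lam|) * expR (- (lam * (n.+1%:R * x))) <= _).
  rewrite ler_wpM2r ?expR_ge0// ler_pM//.
  - by rewrite exprn_ge0//; nra.
  - by have : 0 <= expR lam ^+ r by [exact: exprn_ge0 (ltW e0)]; nra.
rewrite -!expRD ler_expR -[n.+1%:R]natr1; rewrite -natr1 in lamn.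
have n0 : 0 <= n%:R :> R by [].
have r0 : 0 <= r%:R :> R by [].
have nr : r%:R <= n%:R :> R by rewrite ler_nat.
have l1 : lam <= `|lam| by exact: ler_norm.
have l2 : - lam <= `|lam| by rewrite -normrN ler_norm.
have -> : (n%:R - r%:R) * (x * (lam + 2 * lam ^+ 2)) + r%:R * `|lam| -
   lam * ((n%:R + 1) * x) =
   2 * (n%:R - r%:R) * lam ^+ 2 * x + r%:R * `|lam| + (r%:R + 1) * x * - lam.
  by ring.
have s0 := sqr_ge0 lam.
have C1 : 2 * (n%:R - r%:R) * lam ^+ 2 * x <= 1 / 2.
  have P1 : (n%:R - r%:R) * lam ^+ 2 <= n%:R * lam ^+ 2.
    by rewrite ler_wpM2r//; lra.
  have P0 : 0 <= (n%:R - r%:R) * lam ^+ 2 by rewrite mulr_ge0// subr_ge0.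
  have Px := ler_piMr P0 x1.
  rewrite (_ : _ * x = 2 * ((n%:R - r%:R) * lam ^+ 2 * x)); last by ring.
  by lra.
have C2 : (r%:R + 1) * x * - lam <= (r%:R + 1) * `|lam|.
  by rewrite -mulrA ler_wpM2l ?addr_ge0//; nra.
have C3 : r%:R * `|lam| <= r%:R * (1 / 2) by rewrite ler_wpM2l.
move: C1 C2; set a1 := 2 * _ * _ * x; set a2 := _ * - lam; rewrite mulrDl mul1r.
by lra.
Qed.

(** From exp |u| <= exp u + exp (- u). With lam of order n^(-1/2), this says
    that the deviation of k from (n + 1) x has exponential tails at the scale
    n^(1/2), uniformly in x. *)
Lemma stancu_exp_moment (n r : nat) x lam : (2 * r < n)%N -> 0 <= x <= 1 ->
  0 <= lam <= 1 / 2 -> 4 * lam ^+ 2 * n.+1%:R <= 1 ->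
  \sum_(k < n.+1) stancu n k r x * expR (lam * `|k%:R - n.+1%:R * x|) <=
  2 * expR (r%:R + 1).
Proof.
move=> rn x01 /andP[l0 l1] ln.
have P := stancu_mgf n r x lam rn x01.
have Q := stancu_mgf n r x (- lam) rn x01.
rewrite sqrrN normrN in Q; rewrite mulrDl mul1r.
apply: le_trans (lerD (P _ ln) (Q _ ln)); rewrite ?ger0_norm//.
rewrite -big_split/=; apply: ler_sum => k _; rewrite -mulrDr.
apply: ler_wpM2l; first exact: stancu_ge0.
rewrite mulNr -mulrN.
by case: ger0P => _; rewrite (lerDl, lerDr) expR_ge0.
Qed.

End StancuMoments.

(** * A convolution inequality for finite kernels *)

Section DiscreteYoung.
Context {R : realType}.

(** One factor E l of E l ^+ 2 is used for summability. The other one enters the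
    bound E l * b l <= T `^ p^-1, where T = \sum_l E l * b l `^ p, which holds
    because (E l)^p <= E l when E l <= 1 and p >= 1. Squaring the kernel thus
    takes the place of the weighted Jensen inequality. *)
Lemma powR_sum_sqr_kernel (I : finType) (E b : I -> R) (p : R) :
  1 <= p -> (forall l, 0 < E l <= 1) -> (forall l, 0 <= b l) ->
  (\sum_l E l ^+ 2 * b l) `^ p <= (\sum_l E l) `^ p * \sum_l E l * b l `^ p.
Proof.
move=> p1 E01 b0; have p0 : 0 < p by lra.
have E0 l : 0 <= E l by have /andP[/ltW] := E01 l.
pose T := \sum_l E l * b l `^ p; rewrite -/T.
have T0 : 0 <= T by apply: sumr_ge0 => l _; rewrite mulr_ge0 ?powR_ge0.
have Ebt l : E l * b l <= T `^ p^-1.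
  have Eb0 : 0 <= E l * b l by rewrite mulr_ge0.
  rewrite -[leLHS]powRr1// -[X in _ `^ X](mulfV (lt0r_neq0 p0)) powRrM.
  apply: ge0_ler_powR; rewrite ?nnegrE ?powR_ge0 ?invr_ge0 ?(ltW p0)//.
  apply: le_trans (ge1r_powRZ (E01 l) (b0 l) p1) _.
  rewrite /T (bigD1 l)//= lerDl.
  by apply: sumr_ge0 => j _; rewrite mulr_ge0 ?powR_ge0.
have le1 : \sum_l E l ^+ 2 * b l <= (\sum_l E l) * T `^ p^-1.
  rewrite mulr_suml; apply: ler_sum => l _.
  by rewrite expr2 -mulrA ler_wpM2l.
have sE0 : 0 <= \sum_l E l by exact: sumr_ge0.
apply: le_trans (_ : ((\sum_l E l) * T `^ p^-1) `^ p <= _).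
  apply: ge0_ler_powR; rewrite ?nnegrE ?(ltW p0) ?mulr_ge0 ?powR_ge0//.
  by apply: sumr_ge0 => l _; rewrite mulr_ge0 ?exprn_ge0.
by rewrite powRM ?powR_ge0// -powRrM mulVf ?gt_eqF// powRr1.
Qed.

(** Schur's test: the row sums bound the powers of the total masses, and the
    column sums appear after exchanging the summations. *)
Lemma sum_powR_sqr_kernel (I : finType) (E : I -> I -> R) (b : I -> R)
    (p S : R) :
  1 <= p -> (forall i l, 0 < E i l <= 1) -> (forall l, 0 <= b l) ->
  (forall i, \sum_l E i l <= S) -> (forall l, \sum_i E i l <= S) ->
  \sum_i (\sum_l E i l ^+ 2 * b l) `^ p <= S `^ p * S * \sum_l b l `^ p.
Proof.
move=> p1 E01 b0 row col.
have E0 i l : 0 <= E i l by have /andP[/ltW] := E01 i l.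
apply: le_trans (_ : \sum_i S `^ p * \sum_l E i l * b l `^ p <= _).
  apply: ler_sum => i _.
  apply: le_trans (powR_sum_sqr_kernel _ _ _ _ p1 (E01 i) b0) _.
  rewrite ler_wpM2r ?sumr_ge0// => [l _|]; first by rewrite mulr_ge0 ?powR_ge0.
  have s0 : 0 <= \sum_l E i l by exact: sumr_ge0.
  apply: ge0_ler_powR; rewrite ?nnegrE//; first by lra.
  exact: le_trans (row i).
rewrite -mulr_sumr -mulrA ler_wpM2l ?powR_ge0//.
rewrite exchange_big/= mulr_sumr; apply: ler_sum => l _.
by rewrite -mulr_suml ler_wpM2r ?powR_ge0.
Qed.

End DiscreteYoung.

(** * Geometric decay between cells *)

(** Truncated subtractions keep the distance within linear arithmetic on
    natural numbers. *)
Definition ndist (m n : nat) : nat := (m - n + (n - m))%N.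

Lemma natr_ndist {R : realType} (m k : nat) :
  (ndist m k)%:R = `|m%:R - k%:R| :> R.
Proof.
rewrite /ndist; case: (leqP m k) => h.
  rewrite (eqP (h : (m - k == 0)%N)) add0n natrB// distrC ger0_norm//.
  by rewrite subr_ge0 ler_nat.
rewrite (eqP (ltnW h : (k - m == 0)%N)) addn0 natrB 1?ltnW// ger0_norm//.
by rewrite subr_ge0 ler_nat ltnW.
Qed.

Section Decay.
Context {R : realType}.
Variables (d M : nat) (rho : R).
Hypothesis rho01 : 0 < rho < 1.

Lemma sum_geometric_le (n : nat) : \sum_(k < n) rho ^+ k <= (1 - rho)^-1.
Proof.
have /andP[r0 r1] := rho01.
rewrite -[leRHS]mul1r ler_pdivlMr ?subr_gt0// mulrC -opprB mulNr -subrX1 opprB.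
by rewrite gerBl exprn_ge0// ltW.
Qed.

(** The indices on either side of i form a geometric series. *)
Lemma sum_ndist_le (i : 'I_M) :
  \sum_(l < M) rho ^+ ndist l i <= 2 * (1 - rho)^-1.
Proof.
rewrite -(big_mkord xpredT (fun l => rho ^+ ndist l i)).
rewrite (big_cat_nat (n := i))//=; last exact: ltnW.
rewrite mulrDl !mul1r lerD//.
  rewrite big_nat_rev/= big_mkord; have /andP[r0 r1] := rho01.
  apply: le_trans (sum_geometric_le i); apply: ler_sum => l _.
  apply: ler_wiXn2l; rewrite ?ltW//; have := ltn_ord l; rewrite /ndist; lia.
rewrite -[X in \sum_(X <= _ < _) _]add0n big_addn big_mkord.
apply: le_trans (sum_geometric_le (M - i)); apply: ler_sum => l _.
by rewrite (_ : ndist _ _ = l)// /ndist; lia.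
Qed.

Definition decay (i l : {ffun 'I_d -> 'I_M}) : R :=
  \prod_(c < d) rho ^+ ndist (l c) (i c).

Lemma decayC i l : decay i l = decay l i.
Proof. by apply: eq_bigr => c _; congr (_ ^+ _); rewrite /ndist addnC. Qed.

Lemma decay_itv i l : 0 < decay i l <= 1.
Proof.
have /andP[r0 r1] := rho01; rewrite /decay prodr_gt0/= => [|c _].
  by apply: prodr_ile1 => c _; rewrite exprn_ge0 ?exprn_ile1// ltW.
by rewrite exprn_gt0.
Qed.

(** The kernel is a product over the coordinates, so the sum over the cells
    factors into one-dimensional sums. *)
Lemma sum_decay_le i : \sum_l decay i l <= (2 * (1 - rho)^-1) ^+ d.
Proof.
rewrite -(bigA_distr_bigA (fun c (l : 'I_M) => rho ^+ ndist l (i c))).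
rewrite -[X in _ ^+ X]card_ord -prodr_const; apply: ler_prod => c _.
rewrite sum_ndist_le sumr_ge0// => l _.
by rewrite exprn_ge0//; have /andP[/ltW] := rho01.
Qed.

End Decay.

(** * Oscillation of a function along the cells of a grid *)

Section LocalModulus.
Context {R : realType} {d : nat}.
Implicit Types (f : d.-tuple R -> R) (x y z : d.-tuple R).

Lemma bounded_cubeP f : [bounded f x | x in unit_cube R d] ->
  exists B, forall x, unit_cube R d x -> `|f x| <= B.
Proof.
by case=> B [_ /(_ (B + 1))]; rewrite ltrDl => /(_ ltr01); exists (B + 1).
Qed.

Lemma tadd_tsub x y : tadd x (tsub y x) = y.
Proof. by apply: eq_from_tnth => c; rewrite !tnth_mktuple addrC subrK. Qed.

Lemma supnorm_tsub_le x y (e : R) : 0 <= e ->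
  (forall c, `|tnth x c - tnth y c| <= e) -> supnorm (tsub x y) <= e.
Proof. by move=> e0 h; apply: bigmax_le => // c _; rewrite tnth_mktuple. Qed.

Lemma le_local_modulus f x y z (delta : R) : 0 <= delta ->
  [bounded f x | x in unit_cube R d] ->
  unit_cube R d x -> unit_cube R d y ->
  (forall c, `|tnth x c - tnth z c| <= delta / 2) ->
  (forall c, `|tnth y c - tnth z c| <= delta / 2) ->
  `|f x - f y| <= local_modulus f z delta.
Proof.
move=> d0 /bounded_cubeP[B fB] Qx Qy xz yz; apply: ub_le_sup.
  exists (B + B) => _ [t [h [Qt Qh _ _ ->]]].
  by apply: le_trans (ler_normB _ _) _; rewrite lerD ?fB.
have d20 : 0 <= delta / 2 by lra.
by exists y, (tsub x y); rewrite tadd_tsub; split=> //; exact: supnorm_tsub_le.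
Qed.

Lemma local_modulus_ge0 f z (delta : R) : 0 <= local_modulus f z delta.
Proof.
rewrite /local_modulus; set E := [set s | _].
have [supE|/sup_out->//] := pselect (has_sup E).
have [s Es] := supE.1; apply: le_trans (sup_upper_bound supE Es).
by have [t [h [_ _ _ _ ->]]] := Es.
Qed.

End LocalModulus.

Section Cells.
Context {R : realType} {d M : nat}.
Hypothesis M_gt0 : (0 < M)%N.
Local Notation cell := {ffun 'I_d -> 'I_M}.
Implicit Types (i j l : cell) (x y z : d.-tuple R).

(** Closed cells: they cover the cube, faces included. The inequality is scaled
    by M to keep divisions out of the comparisons of indices. *)
Definition in_cell l x : Prop :=
  forall c, (l c)%:R <= M%:R * tnth x c <= (l c).+1%:R.

Definition cell_corner l : d.-tuple R := [tuple (l c)%:R / M%:R | c < d].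

Let M0 : 0 < M%:R :> R. Proof. by rewrite ltr0n. Qed.

Lemma in_cell_corner l : in_cell l (cell_corner l).
Proof.
move=> c; rewrite tnth_mktuple mulrCA divff ?gt_eqF// mulr1 lexx ler_nat.
exact: leqnSn.
Qed.

Lemma in_cell_cube l x : in_cell l x -> unit_cube R d x.
Proof.
move=> lx c; have /andP[a b] := lx c.
have lM : (l c).+1%:R <= M%:R :> R by rewrite ler_nat.
rewrite -(pmulr_rge0 _ M0) (le_trans _ a)//=.
by rewrite -(ler_pM2l M0) mulr1 (le_trans b).
Qed.

(** A coordinate equal to 1 has integer part M after scaling and is put into
    the last cell, M - 1. *)
Lemma exists_cell x : unit_cube R d x -> exists l, in_cell l x.
Proof.
move=> Qx; have x0 c : 0 <= M%:R * tnth x c.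
  by rewrite mulr_ge0//; have /andP[] := Qx c.
have lt c : (minn (Num.truncn (M%:R * tnth x c)) M.-1 < M)%N.
  by rewrite gtn_min ltn_predL M_gt0 orbT.
exists [ffun c => Ordinal (lt c)] => c; rewrite ffunE /=.
have /andP[a b] := truncn_itv (x0 c).
case: leqP => h; first by rewrite a ltW.
rewrite prednK// -{3}[M%:R]mulr1 ler_pM2l//; have /andP[_ ->] := Qx c.
by rewrite andbT (le_trans _ a)// ler_nat ltnW.
Qed.

Lemma near_cells j l x z : in_cell j x -> in_cell l z ->
  (forall c, ndist (j c) (l c) <= 1)%N ->
  forall c, `|tnth x c - tnth z c| <= 2 / M%:R.
Proof.
move=> jx lz jl c; rewrite ler_pdivlMr// -{1}(gtr0_norm M0) -normrM.
have /andP[a1 b1] := jx c; have /andP[a2 b2] := lz c.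
have h1 : (j c).+1%:R <= (l c).+2%:R :> R.
  by rewrite ler_nat; have := jl c; rewrite /ndist; lia.
have h2 : (l c).+1%:R <= (j c).+2%:R :> R.
  by rewrite ler_nat; have := jl c; rewrite /ndist; lia.
rewrite mulrBl ![_ * M%:R]mulrC ler_norml.
rewrite -!natr1 in a1 b1 a2 b2 h1 h2; apply/andP; split; lra.
Qed.

Variables (f : d.-tuple R -> R) (delta : R).
Hypothesis f_bounded : [bounded f x | x in unit_cube R d].
Hypothesis delta_ge : 4 / M%:R <= delta.

(** An infimum over the cell, so that it bounds from below the local modulus at
    every point of the cell. *)
Definition cell_modulus l : R :=
  inf [set local_modulus f z delta | z in in_cell l].

Lemma cell_modulus_ge0 l : 0 <= cell_modulus l.
Proof.
apply: lb_le_inf; first by exists (local_modulus f (cell_corner l) delta);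
  exists (cell_corner l) => //; exact: in_cell_corner.
by move=> _ [z _ <-]; exact: local_modulus_ge0.
Qed.

Lemma cell_modulus_le l z :
  in_cell l z -> cell_modulus l <= local_modulus f z delta.
Proof.
move=> lz; apply: ge_inf; last by exists z.
by exists 0 => _ [y _ <-]; exact: local_modulus_ge0.
Qed.

(** Points of two neighbouring cells are within 2 / M <= delta / 2 of every
    point z of the second cell, so both are admissible in the local modulus at
    z. *)
Lemma near_cells_modulus i j x y : in_cell i x -> in_cell j y ->
  (forall c, ndist (i c) (j c) <= 1)%N -> `|f x - f y| <= cell_modulus j.
Proof.
move=> ix jy ij; apply: lb_le_inf.
  by exists (local_modulus f y delta); exists y.
move=> _ [z jz <-].
have dM : 2 / M%:R <= delta / 2 by have := delta_ge; set u := M%:R^-1; lra.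
have d0 : 0 <= delta by apply: le_trans delta_ge; rewrite divr_ge0 ?ltW.
apply: le_local_modulus => //;
  [exact: in_cell_cube ix|exact: in_cell_cube jy| |]; move=> c;
  apply: le_trans dM.
  exact: near_cells ix jz ij c.
by apply: near_cells jy jz _ c => c'; rewrite /ndist subnn.
Qed.

Lemma step_toward_subproof (i j : 'I_M) :
  ((if (j < i)%N then j.+1 else if (i < j)%N then j.-1 else j) < M)%N.
Proof.
have := ltn_ord i; have := ltn_ord j.
by case: (ltnP j i) => ?; [|case: (ltnP i j) => ?]; lia.
Qed.

Definition step_toward i j : cell :=
  [ffun c => Ordinal (step_toward_subproof (i c) (j c))].

(** Walk from the cell j to the cell i, moving all the coordinates of the cell
    index that differ by one unit towards i at each step. Each step costs the
    modulus of the cell it leaves; the cells visited are distinct, because the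
    sum of the distances decreases, and stay in the box of indices not further
    from i than j. Summing over the whole box instead of the path loses only a
    polynomial factor, which the decay of the kernel absorbs. *)
Lemma chain_cells i j x y : in_cell i x -> in_cell j y ->
  `|f x - f y| <=
  \sum_(l : cell | [forall c, (ndist (l c) (i c) <= ndist (j c) (i c))%N])
     cell_modulus l.
Proof.
move=> ix; have [T] : exists T, forall c, (ndist (j c) (i c) <= T)%N.
  exists (\max_c ndist (j c) (i c)) => c; exact: leq_bigmax.
(* T bounds the number of steps of the walk. *)
elim: T j y => [|T IH] j y jT jy.
  have ij : i = j.
    by apply/ffunP => c; apply: val_inj; have := jT c; rewrite /ndist /=; lia.
  apply: le_trans (_ : cell_modulus j <= _).
    by apply: near_cells_modulus ix jy _ => c; rewrite ij /ndist subnn.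
  rewrite (bigD1 j)/=; last by apply/forallP => c.
  by rewrite lerDl sumr_ge0// => l _; exact: cell_modulus_ge0.
have [ij|ij] := eqVneq i j.
  by apply: IH jy => c; rewrite ij /ndist subnn.
pose j' := step_toward i j.
have j'T c : (ndist (j' c) (i c) <= (ndist (j c) (i c)).-1)%N.
  rewrite /j' ffunE /= /ndist.
  by case: (ltnP (j c) (i c)) => ?; [|case: (ltnP (i c) (j c)) => ?]; lia.
have jj' c : (ndist (j' c) (j c) <= 1)%N.
  rewrite /j' ffunE /= /ndist.
  by case: (ltnP (j c) (i c)) => ?; [|case: (ltnP (i c) (j c)) => ?]; lia.
have step := near_cells_modulus _ _ _ _ (in_cell_corner j') jy jj'.
have j'T' c : (ndist (j' c) (i c) <= T)%N by have := jT c; have := j'T c; lia.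
have rest := IH j' (cell_corner j') j'T' (in_cell_corner j').
(* The corner serves as an arbitrary point of the cell j'. *)
apply: le_trans (ler_distD (f (cell_corner j')) _ _) _.
rewrite (bigD1 j)/=; last by apply/forallP.
rewrite addrC; apply: lerD => //; apply: le_trans rest _.
rewrite [leRHS](bigID (fun l : cell =>
  [forall c, (ndist (l c) (i c) <= ndist (j' c) (i c))%N]))/=.
rewrite -[leLHS]addr0 lerD//; last first.
  by rewrite sumr_ge0// => l _; exact: cell_modulus_ge0.
rewrite le_eqVlt; apply/orP; left; apply/eqP; apply: eq_bigl => l.
apply/idP/idP => [/forallP h|/andP[]//].
apply/andP; split; last by apply/forallP.
apply/andP; split.
  apply/forallP => c; apply: leq_trans (h c) _; have := j'T c; lia.
(* The cell j is outside the smaller box, since some coordinate moved. *)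
apply/eqP => lj; move/eqP: ij; apply; apply/ffunP => c; apply: val_inj => /=.
by have := h c; have := j'T c; rewrite lj /ndist; lia.
Qed.

End Cells.

(** * The pointwise estimate *)

Section PointwiseEstimate.
Context {R : realType} {d : nat}.

Lemma dist_le_add1 (m k : nat) (a b : R) :
  m%:R <= a <= m.+1%:R -> k%:R <= b <= k.+1%:R ->
  `|m%:R - k%:R| <= `|a - b| + 1.
Proof.
rewrite -!natr1 => /andP[a1 a2] /andP[b1 b2]; rewrite ler_norml.
have h1 := ler_norm (a - b); have := ler_norm (b - a); rewrite distrC => h2.
by apply/andP; split; lra.
Qed.

Lemma sum_tuple_prod (J : finType) (F : 'I_d -> J -> R) :
  \sum_(k : d.-tuple J) \prod_(c < d) F c (tnth k c) =
  \prod_(c < d) \sum_(j : J) F c j.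
Proof.
rewrite bigA_distr_bigA /= (reindex (@finfun_of_tuple J d)).
  by apply: eq_bigr => k _; apply: eq_bigr => c _; rewrite ffunE.
by exists (@tuple_of_finfun J d) => k _;
  [exact: finfun_of_tupleK|exact: tuple_of_finfunK].
Qed.

Variables (n r : nat).
Hypothesis rn : (2 * r < n)%N.

Definition stancu_weight (k : d.-tuple 'I_n.+1) (x : d.-tuple R) : R :=
  \prod_(c < d) stancu n (tnth k c) r (tnth x c).

Lemma stancu_weight_ge0 k x : unit_cube R d x -> 0 <= stancu_weight k x.
Proof. by move=> Qx; apply: prodr_ge0 => c _; exact: stancu_ge0. Qed.

Definition grid_point (k : d.-tuple 'I_n.+1) (u : d.-tuple R) : d.-tuple R :=
  [tuple ((tnth k c)%:R + tnth u c) / n.+1%:R | c < d].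

Lemma grid_point_cube k u : unit_cube R d u -> unit_cube R d (grid_point k u).
Proof.
move=> Qu c; rewrite tnth_mktuple; have /andP[u0 u1] := Qu c.
have N0 : 0 < n.+1%:R :> R by rewrite ltr0n.
rewrite divr_ge0 ?addr_ge0//= ler_pdivrMr// mul1r.
have : (tnth k c).+1%:R <= n.+1%:R :> R by rewrite ler_nat.
by rewrite -natr1; lra.
Qed.

(** The weights sum to 1 and the cube has measure 1, so K f x - v is an average
    of the values f (grid_point k u) - v. *)
Lemma kantorovich_sub_le (f : d.-tuple R -> R) (x : d.-tuple R) (v : R)
    (B : d.-tuple 'I_n.+1 -> R) : unit_cube R d x ->
  (forall k u, unit_cube R d u -> `|f (grid_point k u) - v| <= B k) ->
  `|kantorovich n r f x - v| <= \sum_k stancu_weight k x * B k.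
Proof.
move=> Qx fB.
have sumw : \sum_k stancu_weight k x = 1.
  rewrite (sum_tuple_prod _ (fun c (j : 'I_n.+1) => stancu n j r (tnth x c))).
  rewrite big1// => c _; exact: sum_stancu.
rewrite -[v]mul1r -sumw mulr_suml /kantorovich -sumrB.
apply: le_trans (ler_norm_sum _ _ _) _; apply: ler_sum => k _.
rewrite -mulrBr normrM ger0_norm ?stancu_weight_ge0//.
apply: ler_wpM2l; first exact: stancu_weight_ge0.
apply: normr_Rintegral_sub_le => [| |u Qu]; first exact: measurable_unit_cube.
- exact: lebesgue_unit_cube.
- exact: fB.
Qed.

Variables (M : nat) (f : d.-tuple R -> R) (delta : R).
Hypothesis M_gt0 : (0 < M)%N.
Hypothesis M_le : M%:R <= 11 * Num.sqrt n.+1%:R :> R.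
Hypothesis f_bounded : [bounded f x | x in unit_cube R d].
Hypothesis delta_ge : 4 / M%:R <= delta.
Local Notation cell := {ffun 'I_d -> 'I_M}.

(** lam makes 4 lam^2 (n + 1) equal to 1. As M <= 11 (n + 1)^(1/2), a deviation
    s of k from (n + 1) x amounts to at most 22 lam s cells
    ([cell_distance_le]); a decay exp (- D / 22) in the number D of cells is
    thus paid by exp (lam s). It is written rho ^ (2 D), because the
    convolution inequality is about squares of kernels, whence 44. *)
Let lam : R := (2 * Num.sqrt n.+1%:R)^-1.
Let rho : R := expR (- (1 / 44)).

Let s0 : 0 < Num.sqrt n.+1%:R :> R. Proof. by rewrite sqrtr_gt0 ltr0n. Qed.
Let s1 : 1 <= Num.sqrt n.+1%:R :> R.
Proof. by rewrite -[leLHS]sqrtr1 ler_wsqrtr// ler1n. Qed.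
Let lam_itv : 0 <= lam <= 1 / 2.
Proof.
rewrite /lam invr_ge0 mulr_ge0 ?(ltW s0)//= div1r lef_pV2 ?posrE ?mulr_gt0//.
by have := s1; lra.
Qed.
Let lam_sqr : 4 * lam ^+ 2 * n.+1%:R <= 1.
Proof.
rewrite /lam exprVn exprMn sqr_sqrtr ?ler0n// (_ : _ * _ = 1)//.
have : n.+1%:R != 0 :> R by rewrite pnatr_eq0.
by set N := n.+1%:R => N0; field.
Qed.

(** The index distance exceeds M |y_c - x_c| by at most 1, where y is the grid
    point, and y_c - x_c is (k_c - (n + 1) x_c + u_c) / (n + 1). *)
Lemma cell_distance_le (i j : cell) (x : d.-tuple R) k u c :
  in_cell i x -> in_cell j (grid_point k u) -> unit_cube R d u ->
  (ndist (j c) (i c))%:R <=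
    22 * (1 + lam * `|(tnth k c)%:R - n.+1%:R * tnth x c|).
Proof.
move=> ix jy Qu.
have xi := ix c; have := jy c; rewrite tnth_mktuple; set y := (_ + _) / _ => yj.
have /andP[u0 u1] := Qu c.
have N0 : 0 < n.+1%:R :> R by rewrite ltr0n.
have D1 : (ndist (j c) (i c))%:R <= M%:R * `|y - tnth x c| + 1.
  rewrite -[X in X * `|_|]ger0_norm// -normrM mulrBr.
  by rewrite natr_ndist dist_le_add1.
have MN : M%:R / n.+1%:R <= 22 * lam.
  rewrite ler_pdivrMr// (le_trans M_le)//.
  rewrite (_ : 22 * lam * _ = 11 * (n.+1%:R / Num.sqrt n.+1%:R)).
    rewrite -[X in _ <= _ * (X / _)](sqr_sqrtr (ler0n R n.+1)) expr2.
    by rewrite mulfK ?gt_eqF.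
  by rewrite /lam; field; rewrite gt_eqF.
have D2 : M%:R * `|y - tnth x c| <=
    22 * lam * (`|(tnth k c)%:R - n.+1%:R * tnth x c| + 1).
  have -> : y - tnth x c =
     (((tnth k c)%:R - n.+1%:R * tnth x c) + tnth u c) / n.+1%:R.
    by rewrite /y; field; rewrite gt_eqF.
  rewrite normrM [`|n.+1%:R^-1|]ger0_norm ?invr_ge0// [`|_ + _| * _]mulrC mulrA.
  apply: ler_pM => //.
  apply: le_trans (ler_normD _ _) _; rewrite lerD2l ger0_norm//.
have /andP[l0 l1] := lam_itv.
lra.
Qed.

(** Chernoff's argument. In the bound of |f y - f x| by a sum over a box,
    replace the indicator of the box by the product over c of
    exp (1 + lam |k_c - (n + 1) x_c|) rho^(2 |l_c - i_c|), which is at least 1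
    on the box. The sum over k then factors over the coordinates into
    exponential moments of the one-dimensional weights. *)
Lemma kantorovich_cell_estimate (i : cell) x : in_cell i x ->
  `|kantorovich n r f x - f x| <=
  (2 * expR (r%:R + 2)) ^+ d *
    \sum_(l : cell) decay d M rho i l ^+ 2 * cell_modulus f delta l.
Proof.
move=> ix; have Qx := in_cell_cube M_gt0 _ _ ix.
pose g c (k : 'I_n.+1) := expR (1 + lam * `|k%:R - n.+1%:R * tnth x c|).
pose q (l : cell) c := rho ^+ ndist (l c) (i c).
pose B k := \sum_(l : cell) cell_modulus f delta l *
   \prod_(c < d) (g c (tnth k c) * q l c ^+ 2).
have b0 (l : cell) : 0 <= cell_modulus f delta l by exact: cell_modulus_ge0.
apply: le_trans (kantorovich_sub_le f x (f x) B Qx _) _.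
  move=> k u Qu; have [j jy] := exists_cell M_gt0 _ (grid_point_cube k u Qu).
  rewrite distrC.
  apply: le_trans
    (chain_cells M_gt0 f delta f_bounded delta_ge _ _ _ _ ix jy) _.
  rewrite /B big_mkcond/=; apply: ler_sum => l _.
  case: ifP => [/forallP lb|_]; last first.
    apply: mulr_ge0 => //; apply: prodr_ge0 => c _.
    by apply: mulr_ge0; [exact: expR_ge0|exact: sqr_ge0].
  rewrite -[leLHS]mulr1 ler_wpM2l//.
  apply: le_trans (_ : \prod_(c < d) 1 <= _); first by rewrite big1_eq.
  apply: ler_prod => c _.
  rewrite ler01/= /g /q /rho -exprM -expRM_natl -expRD -[leLHS]expR0 ler_expR.
  have := cell_distance_le _ _ _ _ _ c ix jy Qu.
  have : (ndist (l c) (i c))%:R <= (ndist (j c) (i c))%:R :> R.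
    by rewrite ler_nat.
  rewrite natrM; lra.
rewrite /B; under eq_bigr do rewrite mulr_sumr.
rewrite exchange_big/= mulr_sumr; apply: ler_sum => l _.
under eq_bigr do rewrite mulrCA /stancu_weight -big_split/=.
rewrite -mulr_sumr (sum_tuple_prod _ (fun c (k : 'I_n.+1) =>
  stancu n k r (tnth x c) * (g c k * q l c ^+ 2))).
rewrite mulrA [leRHS]mulrC ler_wpM2l// -prodrXl.
rewrite (_ : _ ^+ d = \prod_(c < d) (2 * expR (r%:R + 2))); last first.
  by rewrite prodr_const card_ord.
rewrite -big_split/=; apply: ler_prod => c _; apply/andP; split.
  apply: sumr_ge0 => k _; rewrite mulr_ge0 ?stancu_ge0// mulr_ge0 ?sqr_ge0//.
  exact: expR_ge0.
under eq_bigr do rewrite mulrA; rewrite -mulr_suml ler_wpM2r ?sqr_ge0//.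
under eq_bigr do rewrite /g expRD mulrCA; rewrite -mulr_sumr.
apply: le_trans (ler_wpM2l (expR_ge0 _)
  (stancu_exp_moment n r _ _ rn (Qx c) lam_itv lam_sqr)) _.
by rewrite mulrCA -expRD (_ : 1 + _ = r%:R + 2)//; ring.
Qed.

End PointwiseEstimate.

(** * Integrals of step functions *)

Section StepFunctions.
Context {R : realType} {d M : nat}.
Hypothesis M_gt0 : (0 < M)%N.
Local Notation cell := {ffun 'I_d -> 'I_M}.
Let M0 : 0 < M%:R :> R. Proof. by rewrite ltr0n. Qed.

(** The boolean selects the upper bound: half-open cells if it is true, closed
    ones if it is false. The closed cells cover the cube and serve for upper
    bounds, the half-open ones are disjoint and serve for lower bounds; both
    have measure M^(-d). *)
Definition cell_box (b : bool) (l : cell) : set (euclidean R d) :=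
  box (fun c => Interval (BLeft ((l c)%:R / M%:R))
                         (BSide b ((l c).+1%:R / M%:R))).

Lemma lebesgue_cell_box b l : lebesgue R d (cell_box b l) = (M%:R^-1 ^+ d)%:E.
Proof.
apply: lebesgue_box => c; rewrite lebesgue_measure_itv/= lte_fin.
rewrite ltr_pM2r ?invr_gt0// ltr_nat ltnSn -EFinD -mulrBl -natr1.
by rewrite addrAC subrr add0r mul1r.
Qed.

Lemma in_cell_boxP l x : in_cell l x <-> cell_box false l x.
Proof.
split => h c; have := h c; rewrite in_itv/= ler_pdivrMr// ler_pdivlMr//;
 by rewrite ![_ * M%:R]mulrC.
Qed.

Lemma cell_box_in_cell l x : cell_box true l x -> in_cell l x.
Proof.
move=> h c; have := h c; rewrite in_itv/= ler_pdivrMr// ltr_pdivlMr//.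
by rewrite ![_ * M%:R]mulrC => /andP[-> /ltW].
Qed.

Lemma cell_box_inj l l' x : cell_box true l x -> cell_box true l' x -> l = l'.
Proof.
move=> h h'; apply/ffunP => c; apply: val_inj => /=.
have := h c; have := h' c; rewrite !in_itv/=.
rewrite !ler_pdivrMr// !ltr_pdivlMr// => H H'.
by rewrite -(truncn_def H) -(truncn_def H').
Qed.

Lemma integral_cell_step b (v : cell -> R) : (forall l, 0 <= v l) ->
  (\int[lebesgue R d]_x (\sum_(l : cell) v l * \1_(cell_box b l) x)%:E =
   ((\sum_(l : cell) v l) * M%:R^-1 ^+ d)%:E)%E.
Proof.
move=> v0; under eq_integral do rewrite -sumEFin.
have mC l : measurable (cell_box b l) by exact: measurable_box_euclidean.
rewrite ge0_integral_sum//=; last 2 first.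
- move=> l; apply/measurable_EFinP; apply: measurable_funM => //.
- by move=> l x _; rewrite lee_fin mulr_ge0.
rewrite mulr_suml -sumEFin; apply: eq_bigr => l _.
under eq_integral do rewrite EFinM.
rewrite ge0_integralZl//=.
- rewrite integral_indic// setIT EFinM; congr (_ * _)%E.
  exact: lebesgue_cell_box.
- exact/measurable_EFinP/measurable_indic.
- by rewrite lee_fin.
Qed.

Variable p : R.
Hypothesis p_gt0 : 0 < p.

Definition cube_power_integral (g : d.-tuple R -> R) : \bar R :=
  (\int[lebesgue R d]_x (`|(g \_ (unit_cube R d)) x| `^ p)%:E)%E.

Lemma cube_LnormE g : cube_Lnorm p g = (cube_power_integral g `^ p^-1)%E.
Proof. by rewrite /cube_Lnorm Lnorm.unlock. Qed.

Lemma cube_power_integral_le (g : d.-tuple R -> R) (v : cell -> R) :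
  (forall l, 0 <= v l) -> (forall l x, in_cell l x -> `|g x| <= v l) ->
  (cube_power_integral g <= ((\sum_l v l `^ p) * M%:R^-1 ^+ d)%:E)%E.
Proof.
move=> v0 gv; rewrite -(integral_cell_step false) => [|l]; last exact: powR_ge0.
have t0 (l : cell) x : 0 <= v l `^ p * \1_(cell_box false l) x :> R.
  by rewrite mulr_ge0 ?powR_ge0.
apply: ge0_le_lower_integral => x; first by rewrite lee_fin powR_ge0.
rewrite lee_fin patchE; case: ifPn => [/set_mem Qx|_]; last first.
  by rewrite normr0 powR0 ?gt_eqF// sumr_ge0.
have [l lx] := exists_cell M_gt0 _ Qx.
rewrite (bigD1 l)//= indicE mem_set ?mulr1; last exact/in_cell_boxP.
apply: le_trans (_ : v l `^ p <= _); last by rewrite lerDl sumr_ge0.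
by apply: ge0_ler_powR; rewrite ?nnegrE ?(ltW p_gt0)//; exact: gv.
Qed.

Lemma cube_power_integral_ge (g : d.-tuple R -> R) (v : cell -> R) :
  (forall l, 0 <= v l) -> (forall l x, in_cell l x -> v l <= g x) ->
  (((\sum_l v l `^ p) * M%:R^-1 ^+ d)%:E <= cube_power_integral g)%E.
Proof.
move=> v0 gv; rewrite -(integral_cell_step true) => [|l]; last exact: powR_ge0.
apply: ge0_le_lower_integral => x; rewrite lee_fin.
  by rewrite sumr_ge0// => l _; rewrite mulr_ge0 ?powR_ge0.
have [[l lx]|nx] := pselect (exists l, cell_box true l x); last first.
  rewrite big1 ?powR_ge0// => l _; rewrite indicE memNset ?mulr0// => lx.
  by apply: nx; exists l.
have cx := cell_box_in_cell _ _ lx.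
rewrite (bigD1 l)//= big1 ?addr0; last first.
  move=> l' l'l; rewrite indicE memNset ?mulr0// => l'x.
  by move/eqP: l'l; apply; exact: cell_box_inj l'x lx.
rewrite indicE mem_set// mulr1 patchE mem_set; last exact: in_cell_cube cx.
have gx := gv _ _ cx; have g0 := le_trans (v0 l) gx.
by apply: ge0_ler_powR; rewrite ?nnegrE ?(ltW p_gt0) ?ger0_norm.
Qed.

End StepFunctions.

(** * The global estimate *)

Section GlobalEstimate.
Context {R : realType}.
Variables (d r : nat) (p : R).
Hypothesis p_ge1 : 1 <= p.

(** A comes from the exponential moments in d coordinates, and S bounds the row
    sums of the kernel [decay]; both are independent of f, n and the grid. *)
Definition kantorovich_const : R :=
  let A := (2 * expR (r%:R + 2)) ^+ d in
  let S := (2 * (1 - expR (- (1 / 44)))^-1) ^+ d in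
  (A `^ p * (S `^ p * S)) `^ p^-1.

Let rho01 : 0 < (expR (- (1 / 44)) : R) < 1.
Proof. by rewrite expR_gt0 expR_lt1; lra. Qed.

Lemma kantorovich_const_gt0 : 0 < kantorovich_const.
Proof.
have /andP[_ r1] := rho01.
by rewrite /kantorovich_const
  !(powR_gt0, mulr_gt0, exprn_gt0, invr_gt0, subr_gt0, expR_gt0).
Qed.

Lemma kantorovich_Lnorm_le (n M : nat) (f : d.-tuple R -> R) (delta : R) :
  (2 * r < n)%N -> (0 < M)%N -> M%:R <= 11 * Num.sqrt n.+1%:R :> R ->
  4 / M%:R <= delta -> [bounded f x | x in unit_cube R d] ->
  (cube_Lnorm p (fun x => kantorovich n r f x - f x)%R <=
   kantorovich_const%:E * averaged_modulus f delta p)%E.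
Proof.
move=> rn M0 Ms dM fb; have p0 : 0 < p by exact: lt_le_trans ltr01 p_ge1.
pose rho : R := expR (- (1 / 44)).
pose A : R := (2 * expR (r%:R + 2)) ^+ d.
pose S : R := (2 * (1 - rho)^-1) ^+ d.
pose b (l : {ffun 'I_d -> 'I_M}) := cell_modulus f delta l.
have b0 l : 0 <= b l by exact: cell_modulus_ge0.
pose v i := A * \sum_l decay d M rho i l ^+ 2 * b l.
have A0 : 0 <= A by rewrite exprn_ge0// mulr_ge0// expR_ge0.
have s0 i : 0 <= \sum_l decay d M rho i l ^+ 2 * b l.
  by apply: sumr_ge0 => l _; rewrite mulr_ge0 ?sqr_ge0.
have v0 i : 0 <= v i by rewrite mulr_ge0.
have up := cube_power_integral_le M0 p p0
  (fun x => kantorovich n r f x - f x) v v0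
  (fun i x => kantorovich_cell_estimate n r rn M f delta M0 Ms fb dM i x).
have low := cube_power_integral_ge M0 p p0
  (fun x => local_modulus f x delta) b b0
  (fun l x => cell_modulus_le f delta l x).
have young := sum_powR_sqr_kernel _ (decay d M rho) b p S p_ge1
  (decay_itv d M rho rho01) b0 (sum_decay_le d M rho rho01).
have {}young : \sum_i v i `^ p <= A `^ p * (S `^ p * S) * \sum_l b l `^ p.
  under eq_bigr do rewrite /v powRM//.
  rewrite -mulr_sumr -mulrA ler_wpM2l ?powR_ge0//; apply: young => l.
  by under eq_bigr do rewrite decayC; exact: sum_decay_le.
have K0 : 0 <= A `^ p * (S `^ p * S).
  have /andP[_ r1] := rho01.
  rewrite !mulr_ge0 ?powR_ge0// exprn_ge0// mulr_ge0// invr_ge0 subr_ge0 ltW//.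
rewrite /averaged_modulus !cube_LnormE /kantorovich_const -/rho -/A -/S.
have I0 g : (0 <= @cube_power_integral R d p g)%E.
  by apply: integral_ge0 => x _; rewrite lee_fin powR_ge0.
rewrite -poweR_EFin -poweRM ?lee_fin//.
apply: gt0_ler_poweR; first by rewrite invr_ge0 ltW.
- by rewrite in_itv/= leey I0.
- by rewrite in_itv/= leey mule_ge0// lee_fin.
apply: le_trans up _; apply: le_trans (lee_wpmul2l _ low).
  2: by rewrite lee_fin.
by rewrite -EFinM lee_fin [leRHS]mulrA ler_wpM2r// exprn_ge0// invr_ge0.
Qed.

End GlobalEstimate.

Lemma cell_number_sqrt {R : realType} (n : nat) :
  exists M : nat, [/\ (0 < M)%N, M%:R <= 11 * Num.sqrt n.+1%:R :> R &
    10 * Num.sqrt n.+1%:R <= M%:R :> R].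
Proof.
have s1 : 1 <= Num.sqrt n.+1%:R :> R.
  by rewrite -[leLHS]sqrtr1 ler_wsqrtr// ler1n.
have t0 : 0 <= 10 * Num.sqrt n.+1%:R :> R by lra.
exists (Num.truncn (10 * Num.sqrt n.+1%:R : R)).+1.
have /andP[lo hi] := truncn_itv t0; split => //; last exact: ltW.
by rewrite -natr1; lra.
Qed.

(** Since n >= 1 and r (r - 1) >= 0, the base sigma is at least 1 / (6 (n + 1)),
    which exceeds the square 16 / (100 (n + 1)) of the left-hand side. Since
    2 r < n, sigma is at most 1, so that the power 1 / (2 d) <= 1 / 2 of it is
    at least its square root. *)
Lemma modulus_step_ge {R : realType} (d r n : nat) :
  (0 < d)%N -> (2 * r < n)%N ->
  4 / (10 * Num.sqrt n.+1%:R) <=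
  ((3 * n%:R + 1 + 3 * r%:R * (r%:R - 1)) / (12 * n.+1%:R ^+ 2))
     `^ (2 * d%:R)^-1 :> R.
Proof.
move=> d0 rn; set sigma := (X in _ <= X `^ _).
have N0 : 0 < n.+1%:R :> R by rewrite ltr0n.
have rr : 0 <= 3 * r%:R * (r%:R - 1) :> R.
  case: (r) => [|k]; first by rewrite mulr0 mul0r.
  by rewrite !mulr_ge0// -natr1 addrK.
have rn2 : 2 * r%:R <= n%:R :> R by rewrite -natrM ler_nat ltnW.
have n1 : 1 <= n%:R :> R by rewrite ler1n; lia.
have r0 : 0 <= r%:R :> R by [].
have lo : (4 / (10 * Num.sqrt n.+1%:R)) ^+ 2 <= sigma.
  rewrite expr_div_n exprMn sqr_sqrtr ?ler0n// /sigma.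
  rewrite ler_pdivlMr ?mulr_gt0 ?exprn_gt0//.
  have -> : 4 ^+ 2 / (10 ^+ 2 * n.+1%:R) * (12 * n.+1%:R ^+ 2) =
      192 / 100 * n.+1%:R :> R.
    by move: N0; set N := n.+1%:R => N0; field; rewrite gt_eqF.
  rewrite -natr1; lra.
have sigma0 : 0 < sigma.
  by apply: lt_le_trans lo; rewrite exprn_gt0// divr_gt0// mulr_gt0// sqrtr_gt0.
have sigma1 : sigma <= 1.
  rewrite /sigma ler_pdivrMr ?mulr_gt0 ?exprn_gt0// mul1r -natr1; nra.
apply: le_trans (_ : sigma `^ 2^-1 <= _).
  rewrite powR12_sqrt ?(ltW sigma0)//.
  rewrite -[leLHS]ger0_norm ?divr_ge0 ?mulr_ge0 ?sqrtr_ge0//.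
  by rewrite -sqrtr_sqr ler_wsqrtr.
apply: ger_powR; first by rewrite sigma0.
rewrite lef_pV2 ?posrE ?mulr_gt0 ?ltr0n// ler_peMr// ler1n//.
Qed.

Theorem theorem4p1 (R : realType) (d r : nat) (p : R) :
  (0 < d)%N -> 1 <= p ->
  exists C : R, 0 < C /\
    forall f : d.-tuple R -> R, bounded_measurable f ->
    forall n : nat, (2 * r < n)%N ->
      (cube_Lnorm p (fun x => (kantorovich n r f x - f x)%R) <=
       C%:E * averaged_modulus f
         (((3 * n%:R + 1 + 3 * r%:R * (r%:R - 1)) / (12 * n.+1%:R ^+ 2))
            `^ (2 * d%:R)^-1)%R p)%E.
Proof.
move=> d0 p1; exists (kantorovich_const d r p); split.
  exact: kantorovich_const_gt0.
move=> f [_ fb] n rn.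
have [M [M0 Mle leM]] := @cell_number_sqrt R n.
apply: (kantorovich_Lnorm_le d r p p1 n M) => //.
apply: le_trans (modulus_step_ge d r n d0 rn).
have s0 : 0 < Num.sqrt n.+1%:R :> R by rewrite sqrtr_gt0 ltr0n.
by rewrite ler_pM2l// lef_pV2 ?posrE ?mulr_gt0 ?ltr0n.
Qed.
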